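(* Let $\Bbbk$ be a commutative ring, let $R=\Bbbk_{\mathfrak q}[x_1,\ldots,x_n]$ be a skew polynomial ring with group of colors $G$, and let $I$ be the ideal of $R$ generated by monomials $m_1,\ldots,m_s$. Then the Taylor complex $\mathbb{T}=(T_\bullet,\partial_\bullet)$ of $m_1,\ldots,m_s$ is a $\mathbb{Z}\times G$-graded free $R$-resolution of $R/I$.
   Context: Skew polynomial ring: $\Bbbk$ is a commutative ring, $n\ge 1$, $\mathfrak q=(q_{i,j})$ is an $n\times n$ matrix with entries in $\Bbbk^*$, $q_{i,i}=1$ and $q_{i,j}=q_{j,i}^{-1}$ for all $i,j$. $R=\Bbbk_{\mathfrak q}[x_1,\ldots,x_n]$ is the Ore extension of $\Bbbk$ in the variables $x_1,\dots,x_n$ with $\Bbbk$ central and $x_ix_j=q_{i,j}x_jx_i$. A monomial is $\mathbf{x}^{\mathbf a}=x_1^{a_1}\cdots x_n^{a_n}$, $\mathbf a\in\mathbb{N}^n$ (variables written in this order); the monomials are a basis of $R$ over $\Bbbk$. Gradings: let $\sigma_i$ be the ring automorphism of $R$ fixing $\Bbbk$ with $\sigma_i(x_j)=q_{i,j}x_j$. The group of colors is $G=\langle\sigma_1,\ldots,\sigma_n\rangle$, an abelian group. $R$ is $\mathbb{Z}\times G$-graded: $\mathbf x^{\mathbf a}$ has internal degree $\sum a_id_i$, where $\deg x_i=d_i\in\mathbb{Z}^+$ are fixed, and $G$-degree $\sigma_1^{a_1}\cdots\sigma_n^{a_n}$. All $R$-modules are right $R$-modules with compatible $\mathbb{Z}\times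 G$-grading. Monomial operations: $\mathbf x^{\mathbf b}\mid\mathbf x^{\mathbf a}$ means $b_i\le a_i$ for all $i$, and then $\frac{\mathbf x^{\mathbf a}}{\mathbf x^{\mathbf b}}=\mathbf x^{\mathbf a-\mathbf b}$; $\mathbf x^{\mathbf a}*\mathbf x^{\mathbf b}=\mathbf x^{\mathbf a+\mathbf b}$; $C(\mathbf x^{\mathbf a},\mathbf x^{\mathbf b})\in\Bbbk^*$ is the constant with $\mathbf x^{\mathbf a}\mathbf x^{\mathbf b}=C(\mathbf x^{\mathbf a},\mathbf x^{\mathbf b})\,\mathbf x^{\mathbf a}*\mathbf x^{\mathbf b}$. The lcm of monomials is the monomial whose exponent vector is the componentwise maximum. For monomials $m_1,\ldots,m_s$ and $F\subseteq[s]=\{1,\dots,s\}$, $m_F=\mathrm{lcm}(m_i\mid i\in F)$, $m_\emptyset=1$. Taylor complex of $m_1,\ldots,m_s$: $T_i$ is the free $R$-module with basis $\{e_F\mid F\subseteq[s],|F|=i\}$ ($T_0=R$ with $e_\emptyset=1$), where $e_F$ has the internal degree and $G$-degree of $m_F$, and $\partial_i:T_i\to T_{i-1}$ is the right $R$-linear map $$\partial_i(e_F)=\sum_{i\in F}e_{F\setminus\{i\}}(-1)^{\sigma(F,i)}\,C\!\left(m_{F\setminus\{i\}},\tfrac{m_F}{m_{F\setminus\{i\}}}\right)^{-1}\tfrac{m_F}{m_{F\setminus\{i\}}},\qquad \sigma(F,i)=|\{j\in F: j<i\}|,$$ where in the sum $i$ runs over the elements of $F$. The augmentation is the projection $T_0=R\to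 R/I$. *)

(* Defs.v *)
From HB Require Import structures.
From mathcomp Require Import all_boot all_order all_algebra.
From mathcomp Require Import finmap boolp classical_sets.
From mathcomp Require Import mpoly.
From mathcomp Require Import monalg.

Set Implicit Arguments.
Unset Strict Implicit.
Unset Printing Implicit Defensive.

Import GRing.Theory.

Local Open Scope classical_set_scope.
Local Open Scope ring_scope.

Local Notation "f @_ a" := (monalg.mcoeff a f) : ring_scope.

(* A right R-module is an lmodType over the converse ring R^c: for r : R and
   x : M, the right product x . r is written (r : R^c) *: x. *)

Section Graded.
Variables (R : pzRingType) (Gamma : groupType).

Record direct_sum_decomposition (M : zmodType) (A : Gamma -> set M) : Prop := {
  dsd0 : forall g, A g 0;
  dsdB : forall g x y, A g x -> A g y -> A g (x - y);
  dsd_sum : forall x, exists (s : seq Gamma) (f : Gamma -> M),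
    [/\ uniq s, forall g, A g (f g) & x = \sum_(g <- s) f g];
  dsd_direct : forall (s : seq Gamma) (f : Gamma -> M),
    uniq s -> (forall g, A g (f g)) -> \sum_(g <- s) f g = 0 ->
    forall g, g \in s -> f g = 0 }.

Record graded_ring (A : Gamma -> set R) : Prop := {
  gr_dsd : direct_sum_decomposition A;
  gr_one : A 1%g 1;
  gr_mul : forall g h x y, A g x -> A h y -> A (g * h)%g (x * y) }.

Record graded_module (A : Gamma -> set R) (M : lmodType R^c)
    (AM : Gamma -> set M) : Prop := {
  gm_dsd : direct_sum_decomposition AM;
  gm_act : forall g h x (r : R), AM g x -> A h r ->
    AM (g * h)%g ((r : R^c) *: x) }.

Definition degree_preserving (M N : Type) (AM : Gamma -> set M)
    (AN : Gamma -> set N) (f : M -> N) : Prop :=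
  forall g x, AM g x -> AN g (f x).

Record module_basis (M : lmodType R^c) (J : eqType) (b : J -> M) : Prop := {
  mb_span : forall x, exists (s : seq J) (c : J -> R^c),
    x = \sum_(j <- s) c j *: b j;
  mb_free : forall (s : seq J) (c : J -> R^c),
    uniq s -> \sum_(j <- s) c j *: b j = 0 -> forall j, j \in s -> c j = 0 }.

Definition graded_free_module (A : Gamma -> set R) (M : lmodType R^c)
    (AM : Gamma -> set M) : Prop :=
  graded_module A AM /\
  exists (J : eqType) (b : J -> M) (deg : J -> Gamma),
    module_basis b /\ forall j, AM (deg j) (b j).

Record graded_free_resolution (A : Gamma -> set R)
    (T : nat -> lmodType R^c) (AT : forall i, Gamma -> set (T i))
    (d : forall i, {linear T i.+1 -> T i})
    (M : lmodType R^c) (AM : Gamma -> set M) (eps : {linear T 0%N -> M}) :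
    Prop := {
  gfr_ring : graded_ring A;
  gfr_free : forall i, graded_free_module A (AT i);
  gfr_mod : graded_module A AM;
  gfr_diff : forall i, degree_preserving (AT i.+1) (AT i) (d i);
  gfr_aug : degree_preserving (AT 0%N) AM eps;
  gfr_surj : forall y, exists x, eps x = y;
  gfr_exact0 : forall x, eps x = 0 <-> exists y, d 0%N y = x;
  gfr_exact : forall i x, d i x = 0 <-> exists y, d i.+1 y = x }.

End Graded.

(* The two-sided ideal generated by a family, and the quotient as a right
   module. *)
Section Ideal.
Variables (R : pzRingType) (J : Type) (g : J -> R).

Definition gen_ideal : {pred R} := fun x =>
  `[< exists l : seq (R * J * R), x = \sum_(t <- l) t.1.1 * g t.1.2 * t.2 >].

Lemma gen_idealP x :
  reflect (exists l : seq (R * J * R), x = \sum_(t <- l) t.1.1 * g t.1.2 * t.2)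
          (x \in gen_ideal).
Proof. exact: asboolP. Qed.

Fact gen_ideal_zmod_closed : zmod_closed gen_ideal.
Proof.
split; first by apply/gen_idealP; exists [::]; rewrite big_nil.
move=> x y /gen_idealP[l ->] /gen_idealP[l' ->]; apply/gen_idealP.
exists (l ++ [seq ((- t.1.1, t.1.2), t.2) | t <- l']).
rewrite big_cat big_map /= -sumrN; congr (_ + _).
by apply: eq_bigr => t _; rewrite !mulNr.
Qed.

HB.instance Definition _ :=
  GRing.isZmodClosed.Build R gen_ideal gen_ideal_zmod_closed.

Lemma gen_idealMr x r : x \in gen_ideal -> x * r \in gen_ideal.
Proof.
move=> /gen_idealP[l ->]; apply/gen_idealP.
exists [seq (t.1, t.2 * r) | t <- l].
by rewrite big_map /= mulr_suml; apply: eq_bigr => t _; rewrite mulrA.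
Qed.

Definition ideal_quotient : Type := Quotient.quot gen_ideal.
HB.instance Definition _ := GRing.Zmodule.copy ideal_quotient
  (Quotient.quot gen_ideal).

Definition quotient_pi (x : R) : ideal_quotient :=
  \pi_(Quotient.quot gen_ideal)%qT x.

Definition quotient_act (r : R^c) (x : ideal_quotient) : ideal_quotient :=
  quotient_pi (repr (x : Quotient.quot gen_ideal) * (r : R)).

Lemma quotient_piP x y :
  (quotient_pi x == quotient_pi y) = (x - y \in gen_ideal).
Proof. by rewrite Quotient.idealrBE. Qed.

Lemma quotient_pi_is_zmod_morphism : zmod_morphism quotient_pi.
Proof. exact: pi_is_zmod_morphism. Qed.

HB.instance Definition _ :=
  GRing.isZmodMorphism.Build R ideal_quotient quotient_pi
    quotient_pi_is_zmod_morphism.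

Lemma quotient_piK (x : ideal_quotient) : exists r, x = quotient_pi r.
Proof. by exists (repr (x : Quotient.quot gen_ideal)); rewrite /quotient_pi reprK. Qed.

Lemma quotient_actE (r : R) (x : R) :
  quotient_act r (quotient_pi x) = quotient_pi (x * r).
Proof.
apply/eqP; rewrite quotient_piP -mulrBl gen_idealMr //.
by rewrite -quotient_piP /quotient_pi reprK.
Qed.

Fact quotient_actA (a b : R^c) (x : ideal_quotient) :
  quotient_act a (quotient_act b x) = quotient_act (a * b) x.
Proof. by have [y ->] := quotient_piK x; rewrite !quotient_actE -mulrA. Qed.

Fact quotient_act1 : left_id (1 : R^c) quotient_act.
Proof. by move=> x; have [y ->] := quotient_piK x; rewrite quotient_actE mulr1. Qed.

Fact quotient_actDr : right_distributive quotient_act +%R.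
Proof.
move=> a x y; have [u ->] := quotient_piK x; have [v ->] := quotient_piK y.
by rewrite -raddfD !quotient_actE mulrDl raddfD.
Qed.

Fact quotient_actDl (x : ideal_quotient) :
  {morph (fun r : R^c => quotient_act r x) : a b / a + b}.
Proof.
by move=> a b; have [u ->] := quotient_piK x; rewrite !quotient_actE mulrDr raddfD.
Qed.

HB.instance Definition _ := GRing.Zmodule_isLmodule.Build R^c ideal_quotient
  quotient_actA quotient_act1 quotient_actDr quotient_actDl.

Lemma quotient_piZ (r : R) (x : R) :
  (r : R^c) *: quotient_pi x = quotient_pi (x * r).
Proof. exact: quotient_actE. Qed.

End Ideal.

(* skew_mxV says both that each entry is a unit and that q_ij is the inverse of
   q_ji; no inversion on k is needed, so k is an arbitrary commutative ring. *)
Record skew_matrix (k : comPzRingType) (n : nat) := SkewMatrix {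
  skew_mx :> 'M[k]_n;
  skew_mx_diag : forall i, skew_mx i i = 1;
  skew_mxV : forall i j, skew_mx i j * skew_mx j i = 1 }.

Section ColorConstants.
Variables (k : comPzRingType) (n : nat) (q : skew_matrix k n).
Implicit Types (a b c : multinom n).

(* colorC a b is the constant C(x^a, x^b): each x_i in x^a has to move to the
   right of each x_j in x^b with j < i, and x_i x_j = q_ij x_j x_i. *)
Definition colorC a b : k :=
  \prod_(i < n) \prod_(j < n | (j < i)%N) q i j ^+ (a i * b j).

(* C(x^a, x^b)^-1, by colorCVr below. *)
Definition colorCV a b : k :=
  \prod_(i < n) \prod_(j < n | (j < i)%N) q j i ^+ (a i * b j).

Lemma colorCVr a b : colorC a b * colorCV a b = 1.
Proof.
rewrite -big_split big1 //= => i _; rewrite -big_split big1 //= => j _.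
by rewrite -exprMn skew_mxV expr1n.
Qed.

Lemma colorC0m a : colorC 0%MM a = 1.
Proof.
by rewrite /colorC big1 // => i _; rewrite big1 // => j _; rewrite mnm0E mul0n.
Qed.

Lemma colorCm0 a : colorC a 0%MM = 1.
Proof.
by rewrite /colorC big1 // => i _; rewrite big1 // => j _; rewrite mnm0E muln0.
Qed.

Lemma colorCDl a b c : colorC (a + b)%MM c = colorC a c * colorC b c.
Proof.
rewrite -big_split; apply: eq_bigr => i _ /=.
by rewrite -big_split; apply: eq_bigr => j _; rewrite /= mnmDE mulnDl exprD.
Qed.

Lemma colorCDr a b c : colorC a (b + c)%MM = colorC a b * colorC a c.
Proof.
rewrite -big_split; apply: eq_bigr => i _ /=.
by rewrite -big_split; apply: eq_bigr => j _; rewrite /= mnmDE mulnDr exprD.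
Qed.

End ColorConstants.

(* The free k-module on the monomials: f@_a is the coefficient of x^a in f. *)
Definition skewpoly (k : comPzRingType) (n : nat) (q : skew_matrix k n) : Type :=
  {malg k[multinom n]}.
HB.instance Definition _ k n (q : skew_matrix k n) :=
  GRing.Zmodule.copy (skewpoly q) {malg k[multinom n]}.

(* The product of the scalar x and the monomial x^a. *)
HB.lock Definition skewterm (k : comPzRingType) (n : nat) (q : skew_matrix k n)
  (x : k) (a : multinom n) : skewpoly q := << x *g a >>.

HB.lock Definition skew_mul (k : comPzRingType) (n : nat) (q : skew_matrix k n)
  (f g : skewpoly q) : skewpoly q :=
  \sum_(a <- msupp f) \sum_(b <- msupp g)
    skewterm q (f@_a * g@_b * colorC q a b) (a + b)%MM.

Section SkewPolynomial.
Variables (k : comPzRingType) (n : nat) (q : skew_matrix k n).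
Implicit Types (a b c : multinom n).
Local Notation skewpoly := (skewpoly q).
Local Notation skewterm := (skewterm q).
Local Notation skew_mul := (@skew_mul k n q).
Local Notation colorC := (colorC q).

Definition skewmono a : skewpoly := skewterm 1 a.
Definition skewvar (i : 'I_n) : skewpoly := skewmono U_(i)%MM.

Lemma skewtermE x a : skewterm x a = << x *g a >>.
Proof. by rewrite unlock. Qed.

Lemma coef_skewterm x a b : (skewterm x a)@_b = x *+ (a == b).
Proof. by rewrite skewtermE mcoeffU. Qed.

Lemma skewtermD a : {morph skewterm^~ a : x y / x + y}.
Proof. by move=> x y; rewrite !skewtermE; exact: monalgUD. Qed.

Lemma skewterm0 a : skewterm 0 a = 0.
Proof. by rewrite skewtermE; exact: monalgU0. Qed.

Local Notation term f g a b := (skewterm (f@_a * g@_b * colorC a b) (a + b)%MM).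

Fact skew_mulw (d1 d2 : {fset multinom n}) f g :
  (msupp f `<=` d1)%fset -> (msupp g `<=` d2)%fset ->
  skew_mul f g = \sum_(a <- d1) \sum_(b <- d2) term f g a b.
Proof.
move=> le1 le2; rewrite unlock (big_fset_incl _ le1) /=.
  apply: eq_bigr => a _; apply: big_fset_incl => // b _ /mcoeff_outdom ->.
  by rewrite mulr0 mul0r skewterm0.
move=> a _ /mcoeff_outdom fa.
by rewrite big1 // => b _; rewrite fa !mul0r skewterm0.
Qed.

Fact skew_mul0g : left_zero 0 skew_mul.
Proof. by move=> g; rewrite unlock msupp0 big_seq_fset0. Qed.

Fact skew_mulg0 : right_zero 0 skew_mul.
Proof. by move=> g; rewrite unlock msupp0 big1 // => a _; rewrite big_seq_fset0. Qed.

Fact skew_mulDl : left_distributive skew_mul +%R.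
Proof.
move=> f g h; have le2 := fsubset_refl (msupp h).
rewrite [LHS](skew_mulw (msuppD_le f g) le2).
rewrite (skew_mulw (fsubsetUl _ (msupp g)) le2).
rewrite (skew_mulw (fsubsetUr (msupp f) _) le2).
rewrite -big_split /=; apply: eq_bigr => a _.
rewrite -big_split /=; apply: eq_bigr => b _.
by rewrite mcoeffD !mulrDl skewtermD.
Qed.

Fact skew_mulDr : right_distributive skew_mul +%R.
Proof.
move=> h f g; have le1 := fsubset_refl (msupp h).
rewrite [LHS](skew_mulw le1 (msuppD_le f g)).
rewrite (skew_mulw le1 (fsubsetUl _ (msupp g))).
rewrite (skew_mulw le1 (fsubsetUr (msupp f) _)).
rewrite -big_split /=; apply: eq_bigr => a _.
rewrite -big_split /=; apply: eq_bigr => b _.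
by rewrite mcoeffD mulrDr mulrDl skewtermD.
Qed.

Fact skew_mulUU (x y : k) a b :
  skew_mul (skewterm x a) (skewterm y b) =
  skewterm (x * y * colorC a b) (a + b)%MM.
Proof.
by rewrite !skewtermE (skew_mulw msuppU_le msuppU_le) !big_seq_fset1 !mcoeffUU
  skewtermE.
Qed.

Lemma skewpoly_ind (P : skewpoly -> Prop) :
  P 0 -> (forall f g, P f -> P g -> P (f + g)) ->
  (forall x a, P (skewterm x a)) -> forall f, P f.
Proof.
move=> P0 PD PU f; rewrite (monalgE f).
apply: (@big_ind skewpoly P 0 +%R) => // a _.
by rewrite -[mkmalgU _ _]skewtermE; apply: PU.
Qed.

Fact skew_mul1g : left_id (skewmono 0%MM) skew_mul.
Proof.
apply: skewpoly_ind => [|f g Hf Hg|x a]; first exact: skew_mulg0.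
  by rewrite skew_mulDr Hf Hg.
by rewrite skew_mulUU colorC0m mul1r mulr1 add0m.
Qed.

Fact skew_mulg1 : right_id (skewmono 0%MM) skew_mul.
Proof.
apply: skewpoly_ind => [|f g Hf Hg|x a]; first exact: skew_mul0g.
  by rewrite skew_mulDl Hf Hg.
by rewrite skew_mulUU colorCm0 !mulr1 addm0.
Qed.

Fact skew_mulA : associative skew_mul.
Proof.
move=> f g h; elim/skewpoly_ind: f => [|f f' Hf Hf'|x a].
- by rewrite !skew_mul0g.
- by rewrite !skew_mulDl Hf Hf'.
move Eu: (skewterm x a) => u; elim/skewpoly_ind: g => [|g g' Hg Hg'|y b].
- by rewrite !(skew_mul0g, skew_mulg0).
- by rewrite !(skew_mulDl, skew_mulDr) Hg Hg'.
move Ev: (skewterm y b) => v; elim/skewpoly_ind: h => [|h h' Hh Hh'|z c].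
- by rewrite !skew_mulg0.
- by rewrite !skew_mulDr Hh Hh'.
rewrite -{}Eu -{}Ev !skew_mulUU addmA colorCDl colorCDr; congr (skewterm _ _).
rewrite !mulrA (mulrAC _ (colorC b c) (colorC a b)).
by rewrite (mulrAC _ z (colorC a b)) (mulrAC _ (colorC b c)).
Qed.

HB.instance Definition _ := GRing.Zmodule_isPzRing.Build skewpoly
  skew_mulA skew_mul1g skew_mulg1 skew_mulDl skew_mulDr.

Definition skew_scale (x : k) (f : skewpoly) : skewpoly :=
  skewterm x 0%MM * f.

Lemma skewtermM (x y : k) a b :
  skewterm x a * skewterm y b = skewterm (x * y * colorC a b) (a + b)%MM.
Proof. exact: skew_mulUU. Qed.

Fact skew_scaleA x y f : skew_scale x (skew_scale y f) = skew_scale (x * y) f.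
Proof. by rewrite /skew_scale mulrA skewtermM colorC0m mulr1 addm0. Qed.

Fact skew_scale1 : left_id 1 skew_scale.
Proof. exact: mul1r. Qed.

Fact skew_scaleDr : right_distributive skew_scale +%R.
Proof. by move=> x f g; rewrite /skew_scale mulrDr. Qed.

Fact skew_scaleDl f : {morph skew_scale^~ f : x y / x + y}.
Proof. by move=> x y; rewrite /skew_scale skewtermD mulrDl. Qed.

HB.instance Definition _ := GRing.Zmodule_isLmodule.Build k skewpoly
  skew_scaleA skew_scale1 skew_scaleDr skew_scaleDl.

Lemma skewZterm (x y : k) a : x *: skewterm y a = skewterm (x * y) a.
Proof. by rewrite [LHS]skewtermM colorC0m mulr1 add0m. Qed.

Lemma skewZE (x : k) (f : skewpoly) a : (x *: f)@_a = x * f@_a.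
Proof.
elim/skewpoly_ind: f => [|f g Hf Hg|y b].
- by rewrite scaler0 !mcoeff0 mulr0.
- by rewrite scalerDr !mcoeffD Hf Hg mulrDr.
by rewrite skewZterm !coef_skewterm mulrnAr.
Qed.

Lemma skew_scaleAl (x : k) (f g : skewpoly) : x *: (f * g) = (x *: f) * g.
Proof. exact: mulrA. Qed.

Lemma skew_scaleAr (x : k) (f g : skewpoly) : x *: (f * g) = f * (x *: g).
Proof.
elim/skewpoly_ind: f => [|f f' Hf Hf'|y a].
- by rewrite !mul0r scaler0.
- by rewrite !mulrDl scalerDr Hf Hf'.
move Eu: (skewterm y a) => u; elim/skewpoly_ind: g => [|g g' Hg Hg'|z b].
- by rewrite scaler0 !mulr0 scaler0.
- by rewrite scalerDr !mulrDr scalerDr Hg Hg'.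
by rewrite -{}Eu !(skewZterm, skewtermM) !mulrA (mulrC x y).
Qed.

Lemma skewmonoM a b :
  skewmono a * skewmono b = colorC a b *: skewmono (a + b)%MM.
Proof.
by rewrite skewtermM skewZterm !mul1r mulr1.
Qed.

Lemma skewmono0 : skewmono 0%MM = 1.
Proof. by []. Qed.

Lemma colorC_U i j : colorC U_(i)%MM U_(j)%MM = if (j < i)%N then q i j else 1.
Proof.
rewrite /Defs.colorC (bigD1 i) //= [X in _ * X]big1 ?mulr1; last first.
  move=> l /negPf nl; rewrite big1 // => t _.
  by rewrite mnm1E eq_sym nl mul0n.
case: ifP => lt_ji.
  rewrite (bigD1 j) //= big1 ?mulr1 ?mnm1E ?eqxx ?expr1 // => t /andP[_ /negPf nt].
  by rewrite !mnm1E [j == t]eq_sym nt muln0.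
rewrite big1 // => t lt_ti; rewrite !mnm1E.
have [Etj|_] := eqVneq j t; last by rewrite muln0.
by rewrite Etj lt_ti in lt_ji.
Qed.

Lemma skewvarC i j : skewvar i * skewvar j = q i j *: (skewvar j * skewvar i).
Proof.
rewrite !skewmonoM scalerA !colorC_U addmC.
case: (ltngtP i j) => [lt_ij|lt_ji|/val_inj->]; rewrite ?mulr1 //.
  by rewrite skew_mxV.
by rewrite skew_mx_diag.
Qed.

Lemma skewmono_prod a : skewmono a = \prod_(i < n) skewvar i ^+ a i.
Proof.
have varX i e : skewvar i ^+ e = skewmono (U_(i) *+ e)%MM.
  elim: e => [|e IHe]; first by rewrite expr0 mulm0n.
  rewrite exprS IHe skewmonoM -mulmS -[RHS]scale1r; congr (_ *: _).
  elim: e {IHe} => [|e IHe]; first by rewrite mulm0n colorCm0.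
  by rewrite mulmS colorCDr IHe colorC_U ltnn mulr1.
suff prodE (r : seq 'I_n) : sorted (fun i j : 'I_n => i < j)%N r ->
    \prod_(i <- r) skewvar i ^+ a i = skewmono (\sum_(i <- r) U_(i) *+ a i)%MM.
  rewrite prodE; last first.
    rewrite [index_enum _]unlock -enumT.
    by have:= iota_ltn_sorted 0 n; rewrite -val_enum_ord sorted_map.
  congr skewmono; apply/mnmP => j; rewrite mnm_sumE (bigD1 j) //=.
  rewrite big1 ?addn0; last by move=> i /negPf ni; rewrite mulmnE mnm1E ni.
  by rewrite mulmnE mnm1E eqxx mul1n.
elim: r => [|i r IHr] /= Hr; first by rewrite !big_nil.
have lt_r : all (fun j : 'I_n => i < j)%N r.
  by apply: order_path_min Hr => ? ? ?; apply: ltn_trans.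
rewrite !big_cons IHr ?(path_sorted Hr) // varX skewmonoM -[RHS]scale1r.
congr (_ *: _); rewrite /Defs.colorC big1 // => l _; rewrite big1 // => t lt_tl.
rewrite mulmnE mnm1E; have [El|_] := eqVneq i l; last by [].
rewrite mnm_sumE big_seq big1 ?muln0 // => j /(allP lt_r) lt_ij.
rewrite mulmnE mnm1E; case: eqP => // Ejt.
by rewrite -El -Ejt ltnNge ltnW in lt_tl.
Qed.

(* sigma i is the automorphism scaling x_j by q i j, hence x^a by the product
   of the q i j ^+ a j. *)
Definition color_char (i : 'I_n) a : k := \prod_(j < n) q i j ^+ a j.

Definition sigma (i : 'I_n) (f : skewpoly) : skewpoly :=
  [malg a in msupp f => color_char i a * f@_a].

Lemma color_charD i a b :
  color_char i (a + b)%MM = color_char i a * color_char i b.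
Proof.
by rewrite -big_split; apply: eq_bigr => j _; rewrite /= mnmDE exprD.
Qed.

Lemma color_char0 i : color_char i 0%MM = 1.
Proof. by rewrite /color_char big1 // => j _; rewrite mnm0E. Qed.

Lemma coef_sigma i f a : (sigma i f)@_a = color_char i a * f@_a.
Proof. by rewrite mcoeffE; case: msuppP => //; rewrite mulr0. Qed.

Lemma sigma_term i x a : sigma i (skewterm x a) = skewterm (color_char i a * x) a.
Proof.
apply/malgP => b; rewrite coef_sigma !coef_skewterm.
by have [->|_] := eqVneq a b; rewrite ?mulr0.
Qed.

Fact sigma_is_zmod_morphism i : zmod_morphism (sigma i).
Proof.
by move=> f g; apply/malgP => a; rewrite !(coef_sigma, mcoeffB) mulrBr.
Qed.

HB.instance Definition _ i :=
  GRing.isZmodMorphism.Build skewpoly skewpoly (sigma i)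
    (sigma_is_zmod_morphism i).

Fact sigma_is_monoid_morphism i : monoid_morphism (sigma i).
Proof.
split; first by rewrite [LHS]sigma_term color_char0 mul1r.
move=> f g; elim/skewpoly_ind: f => [|f f' Hf Hf'|x a].
- by rewrite mul0r !raddf0 mul0r.
- by rewrite mulrDl !raddfD mulrDl /= Hf Hf'.
move Eu: (skewterm x a) => u; elim/skewpoly_ind: g => [|g g' Hg Hg'|y b].
- by rewrite mulr0 !raddf0 mulr0.
- by rewrite mulrDr !raddfD mulrDr /= Hg Hg'.
rewrite -{}Eu !(skewtermM, sigma_term) color_charD; congr (skewterm _ _).
by rewrite !mulrA (mulrAC _ (color_char i b) x).
Qed.

HB.instance Definition _ i :=
  GRing.isMonoidMorphism.Build skewpoly skewpoly (sigma i)
    (sigma_is_monoid_morphism i).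

Lemma sigmaZ i : scalable (sigma i).
Proof.
by move=> x f; apply/malgP => a; rewrite skewZE !coef_sigma skewZE mulrCA.
Qed.

Lemma sigma_var i j : sigma i (skewvar j) = q i j *: skewvar j.
Proof.
rewrite sigma_term skewZterm; congr (skewterm (_ * _) _).
rewrite /color_char (bigD1 j) //= big1 ?mulr1 ?mnm1E ?eqxx ?expr1 //.
by move=> l /negPf nl; rewrite mnm1E eq_sym nl.
Qed.

Lemma sigma_bij i : bijective (sigma i).
Proof.
pose chiV a := \prod_(j < n) q j i ^+ a j.
have chiK a : color_char i a * chiV a = 1.
  by rewrite -big_split big1 //= => j _; rewrite -exprMn skew_mxV expr1n.
exists (fun f : skewpoly => [malg a in msupp f => chiV a * f@_a] : skewpoly) => f.
  apply/malgP => a; rewrite mcoeffE -mcoeff_neq0 coef_sigma mulrA [chiV _ * _]mulrC.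
  rewrite chiK mul1r; case: eqP => // /(congr1 ( *%R (chiV a))).
  by rewrite mulrA [chiV _ * _]mulrC chiK mul1r mulr0.
apply/malgP => a; rewrite coef_sigma mcoeffE.
by case: msuppP; rewrite ?mulr0 // mulrA chiK mul1r.
Qed.

(* The subgroup of the automorphism group generated by the sigma i. *)
Inductive is_color : (skewpoly -> skewpoly) -> Prop :=
| is_color1 : is_color id
| is_color_sigma i : is_color (sigma i)
| is_colorM f g : is_color f -> is_color g -> is_color (f \o g)
| is_colorV f g : is_color f -> cancel f g -> cancel g f -> is_color g.

Lemma is_color_bij f : is_color f -> bijective f.
Proof.
elim=> {f} [|i|f g _ bf _ bg|f g _ _ fK gK]; first by exists id.
- exact: sigma_bij.
- exact: bij_comp.
by exists f.
Qed.

Definition color : Type := {f : skewpoly -> skewpoly | is_color f}.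
HB.instance Definition _ := gen_eqMixin color.
HB.instance Definition _ := gen_choiceMixin color.

Lemma color_eqP (f g : color) : sval f =1 sval g -> f = g.
Proof. by case: f g => [f pf] [g pg] /= /funext fg; apply: eq_exist. Qed.

Definition color_one : color := exist _ _ is_color1.
Definition color_mul (f g : color) : color :=
  exist _ _ (is_colorM (svalP f) (svalP g)).

Lemma color_inv_exists (f : color) :
  exists g : color, cancel (sval f) (sval g) /\ cancel (sval g) (sval f).
Proof.
have [g fK gK] := is_color_bij (svalP f).
by exists (exist _ g (is_colorV (svalP f) fK gK)).
Qed.

Definition color_inv (f : color) : color := sval (cid (color_inv_exists f)).

Lemma color_invK f : cancel (sval f) (sval (color_inv f)).
Proof. exact: (svalP (cid (color_inv_exists f))).1. Qed.

Lemma color_invVK f : cancel (sval (color_inv f)) (sval f).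
Proof. exact: (svalP (cid (color_inv_exists f))).2. Qed.

Fact color_mulA : associative color_mul.
Proof. by move=> f g h; apply: color_eqP. Qed.
Fact color_mul1 : left_id color_one color_mul.
Proof. by move=> f; apply: color_eqP. Qed.
Fact color_mulg1 : right_id color_one color_mul.
Proof. by move=> f; apply: color_eqP. Qed.
Fact color_mulV : left_inverse color_one color_inv color_mul.
Proof. by move=> f; apply: color_eqP => x; apply: color_invK. Qed.
Fact color_mulgV : right_inverse color_one color_inv color_mul.
Proof. by move=> f; apply: color_eqP => x; apply: color_invVK. Qed.

HB.instance Definition _ := isGroup.Build color
  color_mulA color_mul1 color_mulg1 color_mulV color_mulgV.

Definition color_sigma (i : 'I_n) : color := exist _ _ (is_color_sigma i).

Definition mono_color a : color :=
  \big[*%g/1%g]_(i < n) (color_sigma i ^+ a i)%g.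

Definition bidegree : Type := (int * color)%type.
HB.instance Definition _ := Choice.copy bidegree (int * color)%type.

Definition bideg_one : bidegree := (0, 1%g).
Definition bideg_mul (g h : bidegree) : bidegree := (g.1 + h.1, (g.2 * h.2)%g).
Definition bideg_inv (g : bidegree) : bidegree := (- g.1, (g.2 ^-1)%g).

Fact bideg_mulA : associative bideg_mul.
Proof. by move=> f g h; rewrite /bideg_mul /= addrA mulgA. Qed.
Fact bideg_mul1 : left_id bideg_one bideg_mul.
Proof. by case=> x f; rewrite /bideg_mul /= add0r mul1g. Qed.
Fact bideg_mulg1 : right_id bideg_one bideg_mul.
Proof. by case=> x f; rewrite /bideg_mul /= addr0 mulg1. Qed.
Fact bideg_mulV : left_inverse bideg_one bideg_inv bideg_mul.
Proof. by case=> x f; rewrite /bideg_mul /= addNr mulVg. Qed.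
Fact bideg_mulgV : right_inverse bideg_one bideg_inv bideg_mul.
Proof. by case=> x f; rewrite /bideg_mul /= addrN mulgV. Qed.

HB.instance Definition _ := isGroup.Build bidegree
  bideg_mulA bideg_mul1 bideg_mulg1 bideg_mulV bideg_mulgV.

(* d i is the internal degree of x_i. *)
Definition mono_bideg (d : 'I_n -> int) a : bidegree :=
  (\sum_(i < n) d i *+ a i, mono_color a).

(* The k-span of the monomials of degree g. *)
Definition skew_comp (d : 'I_n -> int) (g : bidegree) : set skewpoly :=
  [set f | forall a, a \in msupp f -> mono_bideg d a = g].

End SkewPolynomial.

Section Taylor.
Variables (k : comPzRingType) (n : nat) (q : skew_matrix k n).
Variables (d : 'I_n -> int) (s : nat) (m : 'I_s -> multinom n).
Local Notation R := (skewpoly q).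

Definition lcm_mono (F : {set 'I_s}) : multinom n :=
  \big[@mlcm n/0%MM]_(i in F) m i.

(* T_p, an element v being the sum of the e_F v_F. Here R^c^o is R acting on
   itself on the right. *)
Definition taylor_module (p : nat) : lmodType R^c :=
  {ffun {F : {set 'I_s} | #|F| == p} -> R^c^o}.

Lemma taylor_moduleZ p (r : R) (v : {ffun {F : {set 'I_s} | #|F| == p} -> R^c^o})
    F : ((r : R^c) *: v) F = (v F : R) * r.
Proof. by rewrite ffunE. Qed.

(* e_F for #|F| = p, and 0 otherwise. *)
Definition taylor_basis (p : nat) (F : {set 'I_s}) : taylor_module p :=
  [ffun H : {F : {set 'I_s} | #|F| == p} => (val H == F)%:R : R^c^o].

(* The grading for which e_F is homogeneous of the degree of m_F: v is in degree
   g when each v_F is homogeneous of degree deg(m_F)^-1 g. *)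
Definition taylor_comp (p : nat) (g : bidegree q) : set (taylor_module p) :=
  [set v : {ffun {F : {set 'I_s} | #|F| == p} -> R^c^o} |
    forall F, skew_comp d ((mono_bideg q d (lcm_mono (val F)))^-1 * g)%g (v F)].

(* The ring element by which e_{F \ i} is multiplied in the differential of
   e_F; lcm_mono (F :\ i) divides lcm_mono F, so the subtraction is exact. *)
Definition taylor_coef (F : {set 'I_s}) (i : 'I_s) : R :=
  let mF := lcm_mono F in
  let mFi := lcm_mono (F :\ i) in
  ((-1) ^+ #|[set j in F | (j < i)%N]| * colorCV q mFi (mF - mFi)%MM) *:
    skewmono q (mF - mFi)%MM.

Definition taylor_diff_basis (p : nat) (F : {set 'I_s}) : taylor_module p :=
  \sum_(i in F) (taylor_coef F i : R^c) *: taylor_basis p (F :\ i).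

Definition taylor_diff (p : nat) (v : taylor_module p.+1) : taylor_module p :=
  \sum_(F : {F : {set 'I_s} | #|F| == p.+1})
    ((v : {ffun _ -> R^c^o}) F : R^c) *: taylor_diff_basis p (val F).

Fact taylor_diff_is_linear p : linear (@taylor_diff p).
Proof.
move=> r u v; rewrite scaler_sumr -big_split; apply: eq_bigr => F _ /=.
by rewrite !ffunE scalerDl scalerA.
Qed.

HB.instance Definition _ p := GRing.isLinear.Build R^c
  (taylor_module p.+1) (taylor_module p) _ (@taylor_diff p)
  (@taylor_diff_is_linear p).

Definition mono_quotient : lmodType R^c :=
  ideal_quotient (fun i => skewmono q (m i)).

Definition mono_quotient_comp (g : bidegree q) : set mono_quotient :=
  quotient_pi (fun i => skewmono q (m i)) @` skew_comp d g.

Definition empty_index : {F : {set 'I_s} | #|F| == 0%N} :=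
  Sub finset.set0 (introT eqP (cards0 _)).

(* T_0 has the single basis element e_set0, identified with 1. *)
Definition taylor_aug (v : taylor_module 0) : mono_quotient :=
  quotient_pi (fun i => skewmono q (m i))
    ((v : {ffun _ -> R^c^o}) empty_index).

Fact taylor_aug_is_linear : linear taylor_aug.
Proof.
move=> r u v; rewrite /taylor_aug !ffunE (raddfD (quotient_pi _)).
by congr (_ + _); rewrite [RHS]quotient_piZ.
Qed.

HB.instance Definition _ := GRing.isLinear.Build R^c
  (taylor_module 0) mono_quotient _ taylor_aug taylor_aug_is_linear.

End Taylor.

(* Main.v *)
Require Import Defs.
From HB Require Import structures.
From mathcomp Require Import all_boot all_order all_algebra.
From mathcomp Require Import finmap boolp classical_sets.
From mathcomp Require Import mpoly.
From mathcomp Require Import monalg.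

Set Implicit Arguments.
Unset Strict Implicit.
Unset Printing Implicit Defensive.

Import GRing.Theory.

Local Open Scope ring_scope.

(* The map sending the basis element e_F to x^(m_F) embeds T_p into the
   functions from p-element subsets of [s] to R. As x^(m_(F \ i)) times the
   coefficient of the differential at (F, i) is the signed monomial x^(m_F),
   the differential becomes the boundary map of the full simplex on [s], with
   no color constant left, so it squares to zero. A monomial x^a occurs in the
   image only over subsets F of {i | m_i divides x^a}. When this set is
   nonempty, which is automatic in positive degree and means x^a \in I in
   degree 0, coning over one of its vertices contracts the component of
   exponent a. *)

Local Notation "f @_ a" := (monalg.mcoeff a f) : ring_scope.

(** * Direct sum decompositions from homogeneous projections *)

Section HomogeneousParts.
Variables (Gamma : groupType) (M : zmodType) (A : Gamma -> set M).

(** The projections are kept as data, so that directness follows by applying [pr h] to a vanishing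
    sum. *)
Record homogeneous_parts (pr : Gamma -> M -> M) : Prop := {
  hp_zmod : forall g, zmod_morphism (pr g);
  hp_in : forall g x, A g (pr g x);
  hp_id : forall g x, A g x -> pr g x = x;
  hp_out : forall g h x, A g x -> h != g -> pr h x = 0;
  hp_sum : forall x, exists2 s : seq Gamma, uniq s &
    x = \sum_(g <- s) pr g x }.

Variable pr : Gamma -> M -> M.
Hypothesis prP : homogeneous_parts pr.

HB.instance Definition _ g :=
  GRing.isZmodMorphism.Build M M (pr g) (hp_zmod prP g).

Lemma hp_sumE (s : seq Gamma) (f : Gamma -> M) h :
  uniq s -> (forall g, A g (f g)) -> h \in s ->
  pr h (\sum_(g <- s) f g) = f h.
Proof.
move=> us Af hs; rewrite raddf_sum (bigD1_seq h) //= (hp_id prP) //.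
rewrite big1 ?addr0 // => g nhg.
by rewrite (hp_out prP (Af g)) // eq_sym.
Qed.

(** The second hypothesis makes the kernel of [pi] homogeneous. For directness, lift each component
    to a homogeneous [u g]: the sum of the lifts lies in the kernel, hence so does its part [u h].
    Applied with the identity for R and T_p, and with the quotient map for R/I. *)
Lemma direct_sum_image (N : zmodType) (pi : {additive M -> N}) :
  (forall y, exists x, y = pi x) ->
  (forall g x, pi x = 0 -> pi (pr g x) = 0) ->
  direct_sum_decomposition (fun g => pi @` A g)%classic.
Proof.
move=> pi_surj pi_ker; have A0 g : A g 0.
  by rewrite -(raddf0 (pr g)); apply: hp_in prP _ _.
split.
- by move=> g; exists 0; [exact: A0|exact: raddf0].
- move=> g _ _ [x Ax <-] [y Ay <-]; exists (x - y); last exact: raddfB.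
  by rewrite -(hp_id prP Ax) -(hp_id prP Ay) -raddfB; apply: hp_in prP _ _.
- move=> y; have [x ->] := pi_surj y; have [s us xE] := hp_sum prP x.
  exists s, (fun g => pi (pr g x)); split=> // [g|].
    by exists (pr g x) => //; apply: hp_in prP _ _.
  by rewrite {1}xE raddf_sum.
move=> s f us Af f0 h hs.
have fE g : exists x, A g x /\ pi x = f g by have [x] := Af g; exists x.
have {fE}[u uP] := choice fE.
rewrite -(uP h).2 -(hp_sumE (f := u) us _ hs); last by move=> g; case: (uP g).
apply: pi_ker; rewrite raddf_sum -[RHS]f0.
by apply: eq_bigr => g _; case: (uP g).
Qed.

Lemma direct_sum_parts : direct_sum_decomposition A.
Proof.
have -> : A = (fun g => idfun @` A g)%classic.
  by apply: funext => g; rewrite image_id.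
apply: direct_sum_image => [y|g x /= ->]; first by exists y.
exact: raddf0.
Qed.

End HomogeneousParts.

(** * Supports, restriction to sets of exponents, division by a monomial *)

Section Support.
Variables (k : comPzRingType) (n : nat) (q : skew_matrix k n).
Local Notation R := (skewpoly q).
Implicit Types (P Q S : multinom n -> Prop) (C : pred (multinom n)).
Implicit Types (f g : R) (a b : multinom n) (x : k).

(** Degrees, divisibility by a monomial and membership in I are all conditions of this form;
    [skew_comp d g] unfolds to one. *)
Definition supp_in P f := forall a, a \in msupp f -> P a.

Lemma supp_inP P f : supp_in P f <-> forall a, f@_a != 0 -> P a.
Proof.
by split=> Pf a; [rewrite mcoeff_neq0|rewrite -mcoeff_neq0]; apply: Pf.
Qed.

Lemma supp_in0 P : supp_in P (0 : R).
Proof. by apply/supp_inP => a; rewrite mcoeff0 eqxx. Qed.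

Lemma supp_inD P f g : supp_in P f -> supp_in P g -> supp_in P (f + g).
Proof.
move=> /supp_inP Pf /supp_inP Pg; apply/supp_inP => a; rewrite mcoeffD.
have [/Pf //|] := boolP (f@_a != 0).
by rewrite negbK => /eqP ->; rewrite add0r => /Pg.
Qed.

Lemma supp_in_sum P (J : Type) (r : seq J) (C : pred J) (F : J -> R) :
  (forall j, C j -> supp_in P (F j)) -> supp_in P (\sum_(j <- r | C j) F j).
Proof.
by move=> PF; apply: big_ind => //; [exact: supp_in0|exact: supp_inD].
Qed.

Lemma supp_in_term P x a : P a -> supp_in P (skewterm q x a).
Proof.
move=> Pa; apply/supp_inP => b; rewrite coef_skewterm.
by have [<-|_] := eqVneq a b; rewrite ?mulr0n ?eqxx.
Qed.

Lemma supp_inZ P x f : supp_in P f -> supp_in P (x *: f).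
Proof.
move=> /supp_inP Pf; apply/supp_inP => a; rewrite skewZE => nz; apply: Pf.
by apply: contraNneq nz => ->; rewrite mulr0.
Qed.

Lemma skewpolyE f : f = \sum_(a <- msupp f) skewterm q f@_a a.
Proof.
by rewrite {1}(monalgE f); apply: eq_bigr => a _; rewrite skewtermE.
Qed.

Lemma supp_inM P Q S f g : supp_in P f -> supp_in Q g ->
  (forall a b, P a -> Q b -> S (a + b)%MM) -> supp_in S (f * g).
Proof.
move=> Pf Qg PQS; rewrite (skewpolyE f) mulr_suml big_seq.
apply: supp_in_sum => a fa; rewrite (skewpolyE g) mulr_sumr big_seq.
apply: supp_in_sum => b gb; rewrite skewtermM.
by apply: supp_in_term; apply: PQS; [exact: Pf|exact: Qg].
Qed.

Definition restrict (C : pred (multinom n)) f : R :=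
  [malg a in msupp f => if C a then f@_a else 0].

Lemma coef_restrict C f a : (restrict C f)@_a = if C a then f@_a else 0.
Proof. by rewrite mcoeffE; case: msuppP => //; case: ifP. Qed.

Fact restrict_is_zmod_morphism C : zmod_morphism (restrict C).
Proof.
move=> f g; apply/malgP => a; rewrite !(mcoeffB, coef_restrict).
by case: ifP; rewrite ?subr0.
Qed.
HB.instance Definition _ C :=
  GRing.isZmodMorphism.Build R R (restrict C) (restrict_is_zmod_morphism C).

Fact restrict_is_scalable C : scalable (restrict C).
Proof.
move=> x f; apply/malgP => a; rewrite skewZE !coef_restrict skewZE.
by case: ifP; rewrite ?mulr0.
Qed.
HB.instance Definition _ C :=
  GRing.isScalable.Build k R R *:%R (restrict C) (restrict_is_scalable C).

Lemma restrict_in P Q C f : supp_in P f -> (forall a, P a -> C a -> Q a) ->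
  supp_in Q (restrict C f).
Proof.
move=> /supp_inP Pf PCQ; apply/supp_inP => a; rewrite coef_restrict.
by case: ifP => [Ca /Pf Pa|]; [exact: PCQ|rewrite eqxx].
Qed.

Lemma restrict_id C f : supp_in C f -> restrict C f = f.
Proof.
move=> /supp_inP Cf; apply/malgP => a; rewrite coef_restrict.
have [->|/Cf ->//] := eqVneq f@_a 0.
by rewrite if_same.
Qed.

Lemma restrict0 P C f : supp_in P f -> (forall a, C a -> ~ P a) ->
  restrict C f = 0.
Proof.
move=> /supp_inP Pf CP; apply/malgP => a; rewrite coef_restrict mcoeff0.
case: ifP => // /CP nP.
by have [//|/Pf] := eqVneq f@_a 0.
Qed.

(* A quotient only when x^b divides all monomials of f: a - b is truncated. *)
Definition mono_lquo b f : R :=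
  \sum_(a <- msupp f) skewterm q (colorCV q b (a - b)%MM * f@_a) (a - b)%MM.

Lemma mono_lquoK b f : supp_in (fun a => (b <= a)%MM) f ->
  skewmono q b * mono_lquo b f = f.
Proof.
move=> bf; rewrite [RHS](skewpolyE f) mulr_sumr big_seq [RHS]big_seq.
apply: eq_bigr => a /bf ba; rewrite skewtermM mul1r addmC submK //.
by rewrite mulrAC (mulrC (colorCV _ _ _)) colorCVr mul1r.
Qed.

Lemma coef_monoM b f a :
  (skewmono q b * f)@_(b + a)%MM = colorC q b a * f@_a.
Proof.
elim/skewpoly_ind: f => [|f g Hf Hg|x c].
- by rewrite mulr0 !mcoeff0 mulr0.
- by rewrite mulrDr !mcoeffD Hf Hg mulrDr.
rewrite skewtermM !coef_skewterm mul1r ![(b + _)%MM]addmC.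
rewrite (inj_eq (@addIm _ b)).
by have [->|_] := eqVneq c a; rewrite ?mulr0n ?mulr0 // !mulr1n mulrC.
Qed.

(** Left multiplication by x^b shifts exponents and scales each coefficient by a unit [colorC], so
    it is injective even if [k] has zero divisors. *)
Lemma mono_mulI b : injective ( *%R (skewmono q b)).
Proof.
move=> f g E; apply/malgP => a.
have /(congr1 ( *%R (colorCV q b a))) := coef_monoM b f a.
by rewrite E coef_monoM !mulrA ![colorCV _ _ _ * _]mulrC colorCVr !mul1r.
Qed.

Lemma supp_in_monoM b f : supp_in (fun a => (b <= a)%MM) (skewmono q b * f).
Proof.
apply: (@supp_inM (fun a => a = b) (fun=> True)) => //.
  exact: supp_in_term.
by move=> _ c -> _; apply: lem_addr.
Qed.

(** Here [h] sorts the monomials of [f]: by degree for the gradings, by chosen cone point for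
    exactness. *)
Lemma restrict_sum (T : eqType) (h : multinom n -> T) (s : seq T) f :
  uniq s -> supp_in (fun a => h a \in s) f ->
  f = \sum_(t <- s) restrict (fun a => h a == t) f.
Proof.
move=> us /supp_inP hs; apply/malgP => a; rewrite raddf_sum /=.
have [fa0|/hs has] := eqVneq f@_a 0.
  by rewrite fa0 big1 // => t _; rewrite coef_restrict fa0 if_same.
rewrite (bigD1_seq (h a)) //= coef_restrict eqxx big1 ?addr0 // => t nt.
by rewrite coef_restrict eq_sym (negPf nt).
Qed.

End Support.

(** * The gradings of R, of R/I and of the Taylor modules *)

Section Grading.
Variables (k : comPzRingType) (n : nat) (q : skew_matrix k n).
Variable d : 'I_n -> int.
Local Notation R := (skewpoly q).
Implicit Types (f : R) (a b : multinom n) (g : bidegree q).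

(** Each [sigma i] is diagonal on the monomials, which reduces identities between these colors to
    identities of scalars in the commutative ring [k]. *)
Lemma coef_mono_color a f b :
  (sval (mono_color q a) f)@_b = (\prod_(i < n) color_char q i b ^+ a i) * f@_b.
Proof.
rewrite /mono_color; elim: (index_enum _) f => [|i r IHr] f.
  by rewrite !big_nil mul1r.
rewrite !big_cons -mulrA -IHr /=.
move: (sval _ f) => h; elim: (a i) => [|e IHe].
  by rewrite expg0 expr0 mul1r.
by rewrite expgS exprS /= coef_sigma IHe mulrA.
Qed.

Lemma mono_bideg0 : mono_bideg q d 0%MM = 1%g.
Proof.
congr (_, _); first by rewrite big1 // => i _; rewrite mnm0E mulr0n.
apply: color_eqP => f; apply/malgP => b; rewrite coef_mono_color big1 ?mul1r //.
by move=> i _; rewrite mnm0E expr0.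
Qed.

Lemma mono_bidegD a b :
  mono_bideg q d (a + b)%MM = (mono_bideg q d a * mono_bideg q d b)%g.
Proof.
congr (_, _).
  by rewrite -big_split; apply: eq_bigr => i _; rewrite /= mnmDE mulrnDr.
apply: color_eqP => f; apply/malgP => c; rewrite /= !coef_mono_color mulrA.
congr (_ * _); rewrite -big_split; apply: eq_bigr => i _.
by rewrite /= mnmDE exprD.
Qed.

Lemma skew_comp_parts : homogeneous_parts (skew_comp d)
  (fun g => @restrict k n q (fun a => mono_bideg q d a == g)).
Proof.
split=> [g|g f|g f|g h f fg nhg|f].
- exact: raddfB.
- by apply: (restrict_in (P := fun=> True)) => // a _ /eqP.
- by move=> fg; apply: restrict_id => a /fg ->.
- by apply: (restrict0 fg) => a /eqP ->; apply/eqP.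
exists (undup [seq mono_bideg q d a | a <- msupp f]); first exact: undup_uniq.
apply: restrict_sum; first exact: undup_uniq.
by move=> a fa; rewrite mem_undup map_f.
Qed.

Lemma skew_compM g h f f' : skew_comp d g f -> skew_comp d h f' ->
  skew_comp d (g * h)%g (f * f').
Proof.
by move=> fg fh; apply: (supp_inM fg fh) => a b <- <-; apply: mono_bidegD.
Qed.

Lemma skew_comp_graded : graded_ring (@skew_comp k n q d).
Proof.
split; first exact: direct_sum_parts skew_comp_parts.
  by apply: supp_in_term; apply: mono_bideg0.
exact: skew_compM.
Qed.

Variables (s : nat) (m : 'I_s -> multinom n).

(** Exponents add in products, so multiples of x^(m_i) are supported above m_i. Conversely, a term
    at an exponent above m_i is a right multiple of x^(m_i), with [colorCV] cancelling the constant
    of the product. *)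
Lemma mono_idealP f :
  f \in gen_ideal (fun i => skewmono q (m i)) <->
  supp_in (fun a => exists i, (m i <= a)%MM) f.
Proof.
split=> [/gen_idealP[l ->]|sf].
  apply: supp_in_sum => -[[u i] w] _ /=.
  apply: (@supp_inM _ _ _ (fun a => (m i <= a)%MM) (fun=> True)) => //.
    apply: (@supp_inM _ _ _ (fun=> True) (fun a => a = m i)) => //.
      exact: supp_in_term.
    by move=> a _ _ ->; apply: lem_addl.
  by move=> a b mia _; exists i; apply: lepm_trans mia (lem_addr _ _).
rewrite (skewpolyE f) big_seq; apply: rpred_sum => a /sf[i mia].
apply/gen_idealP.
exists [:: ((1, i),
  skewterm q (colorCV q (m i) (a - m i)%MM * f@_a) (a - m i)%MM)].
rewrite big_seq1 /= mul1r skewtermM mul1r mulrAC (mulrC (colorCV _ _ _)).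
by rewrite colorCVr mul1r addmC submK.
Qed.

Lemma quotient_pi0 f :
  (quotient_pi (fun i => skewmono q (m i)) f = 0) <->
  supp_in (fun a => exists i, (m i <= a)%MM) f.
Proof.
rewrite -mono_idealP -[0](raddf0 (quotient_pi _)); split=> [/eqP|fI].
  by rewrite quotient_piP subr0.
by apply/eqP; rewrite quotient_piP subr0.
Qed.

Lemma mono_quotient_graded :
  graded_module (@skew_comp k n q d) (@mono_quotient_comp k n q d s m).
Proof.
split.
  apply: (direct_sum_image (pi := quotient_pi _) skew_comp_parts).
    exact: quotient_piK.
  by move=> g f /quotient_pi0 sf; apply/quotient_pi0; apply: (restrict_in sf).
move=> g h _ r [f fg <-] rh; rewrite [_ *: _]quotient_piZ.
by exists (f * r) => //; apply: skew_compM.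
Qed.

Local Notation taylor_index p := {F : {set 'I_s} | #|F| == p}.
Local Notation taylor_ffun p := {ffun taylor_index p -> (skewpoly q)^c^o}.

Definition taylor_part (p : nat) g (v : taylor_module q s p) :
    taylor_module q s p :=
  [ffun F => restrict
    (fun a => (mono_bideg q d (lcm_mono m (val F)) * mono_bideg q d a)%g == g)
    ((v : taylor_ffun p) F)].

Lemma taylor_comp_parts p :
  homogeneous_parts (@taylor_comp k n q d s m p) (@taylor_part p).
Proof.
split.
- by move=> g u v; apply/ffunP => F; rewrite !ffunE raddfB.
- move=> g v F; rewrite ffunE.
  apply: (restrict_in (P := fun=> True)) => // a _ /eqP <-.
  by rewrite mulKg.
- move=> g v vg; apply/ffunP => F; rewrite ffunE restrict_id // => a /vg ->.
  by rewrite mulVKg.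
- move=> g h v vg nhg; apply/ffunP => F; rewrite !ffunE.
  apply: (restrict0 (vg F)) => a /eqP hE E; move: nhg.
  by rewrite -hE E mulVKg eqxx.
move=> v.
(* The degrees of all terms e_F x^a occurring in [v]. *)
pose gs := undup (flatten [seq [seq
  (mono_bideg q d (lcm_mono m (val F)) * mono_bideg q d a)%g |
    a <- msupp ((v : taylor_ffun p) F)] | F : taylor_index p]).
exists gs; first exact: undup_uniq.
apply/ffunP => F; rewrite sum_ffunE.
rewrite [LHS](@restrict_sum _ _ _ _
  (fun a => mono_bideg q d (lcm_mono m (val F)) * mono_bideg q d a)%g gs).
- by apply: eq_bigr => g _; rewrite ffunE.
- exact: undup_uniq.
move=> a va; rewrite mem_undup; apply/flattenP.
by eexists; [apply: map_f; rewrite mem_enum|apply: map_f va].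
Qed.

Lemma taylor_basis_comp p (F : {set 'I_s}) :
  @taylor_comp k n q d s m p (mono_bideg q d (lcm_mono m F))
    (taylor_basis q p F).
Proof.
move=> H; rewrite ffunE; case: eqP => [->|_]; last exact: supp_in0.
by rewrite mulVg; apply: supp_in_term; apply: mono_bideg0.
Qed.

Lemma taylor_basis_sum p (c : taylor_index p -> R) :
  \sum_F (c F : R^c) *: taylor_basis q p (val F) =
    finfun c :> taylor_module q s p.
Proof.
apply/ffunP => H; rewrite sum_ffunE (bigD1 H) //= !ffunE eqxx.
rewrite [_ *: _]mul1r big1 ?addr0 // => F nFH; rewrite !ffunE.
by rewrite [val H == _]eq_sym (inj_eq val_inj) (negPf nFH) [LHS]mul0r.
Qed.

Lemma taylor_graded_free p :
  graded_free_module (@skew_comp k n q d) (@taylor_comp k n q d s m p).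
Proof.
split.
  split; first exact: direct_sum_parts (taylor_comp_parts p).
  move=> g h v r vg rh F; rewrite taylor_moduleZ mulgA.
  exact: skew_compM.
exists (taylor_index p), (fun F => taylor_basis q p (val F)),
  (fun F => mono_bideg q d (lcm_mono m (val F))).
split; last by move=> F; apply: taylor_basis_comp.
split=> [v|r c ur c0 F Fr].
  exists (index_enum _), (v : taylor_ffun p).
  by rewrite taylor_basis_sum; apply/ffunP => F; rewrite ffunE.
have := congr1 (fun v : taylor_ffun p => v F) c0; rewrite !ffunE => <-.
(* Extended by zero outside [r], the coefficients are indexed by all F, and [taylor_basis_sum] reads
   them off. *)
pose c' j : R^c := if j \in r then c j else 0.
have -> : \sum_(j <- r) c j *: taylor_basis q p (val j) =
    \sum_j c' j *: taylor_basis q p (val j).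
  rewrite big_uniq //= big_mkcond; apply: eq_bigr => j _.
  by rewrite /c'; case: ifP => // _; rewrite scale0r.
by rewrite taylor_basis_sum ffunE /c' Fr.
Qed.

End Grading.

(** Off the diagonal the terms at (i, j) and (j, i) cancel. The vanishing of [t i i] is a separate
    hypothesis because [V] may have 2-torsion. *)
Lemma antisym_sum (V : zmodType) (s : nat) (t : 'I_s -> 'I_s -> V) :
  (forall i, t i i = 0) -> (forall i j, t i j = - t j i) ->
  \sum_(i < s) \sum_(j < s) t i j = 0.
Proof.
move=> tii tij.
have -> : \sum_(i < s) \sum_(j < s) t i j =
    \sum_(i < s) \sum_(j < s) (if (i < j)%N then t i j else 0) +
    \sum_(i < s) \sum_(j < s) (if (i < j)%N then 0 else t i j).
  rewrite -big_split; apply: eq_bigr => i _; rewrite -big_split.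
  by apply: eq_bigr => j _ /=; case: ifP => _; rewrite ?addr0 ?add0r.
rewrite [X in _ + X]exchange_big -big_split big1 // => i _.
rewrite -big_split big1 // => j _ /=.
case: ltngtP => [_|_|/val_inj ->]; last by rewrite tii addr0.
  by rewrite tij addNr.
exact: addr0.
Qed.

(** * Signs, boundary and cones on the full simplex *)

Section Simplex.
Variables (k : comPzRingType) (V : lmodType k) (s : nat).
Implicit Types (F H : {set 'I_s}) (i j : 'I_s) (c : {set 'I_s} -> V).

Definition simplex_sign F i : k := (-1) ^+ #|[set j in F | (j < i)%N]|.

Lemma simplex_sign_sqr F i : simplex_sign F i * simplex_sign F i = 1.
Proof. by rewrite /simplex_sign -expr2 sqrr_sign. Qed.

Lemma simplex_signU F i j : i \notin F ->
  simplex_sign (i |: F) j = (-1) ^+ (i < j)%N * simplex_sign F j.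
Proof.
move=> iF; rewrite -exprD; congr (_ ^+ _).
have [lt_ij|ge_ij] := boolP (i < j)%N.
  have -> : [set l in i |: F | (l < j)%N] = i |: [set l in F | (l < j)%N].
    by apply/setP => l; rewrite !inE; have [->|] := eqVneq l i.
  by rewrite cardsU1 inE (negPf iF).
apply: eq_card => l; rewrite !inE; have [->|//] := eqVneq l i.
by rewrite (negPf ge_ij) !andbF.
Qed.

Lemma simplex_signD F i : simplex_sign (F :\ i) i = simplex_sign F i.
Proof.
congr (_ ^+ _); apply: eq_card => l; rewrite !inE.
by have [->|//] := eqVneq l i; rewrite ltnn !andbF.
Qed.

(* The transpose of the usual indexing: c F is the coefficient of the face F. *)
Definition boundary c H : V :=
  \sum_(i | i \notin H) simplex_sign H i *: c (i |: H).

(** The face obtained by adding i and j to H arises in two orders; for distinct i and j exactly one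
    order gains a sign from [simplex_signU], so the terms are antisymmetric. *)
Lemma boundary_boundary c H : boundary (boundary c) H = 0.
Proof.
pose t i j := if [&& i \notin H, j \notin H & i != j] then
  (simplex_sign H i * simplex_sign (i |: H) j) *: c (j |: (i |: H)) else 0.
rewrite -[RHS](@antisym_sum _ _ t) => [|i|i j].
- rewrite [LHS]big_mkcond; apply: eq_bigr => i _.
  have [iH|iH] := boolP (i \in H).
    by rewrite big1 // => j _; rewrite /t iH.
  rewrite scaler_sumr big_mkcond; apply: eq_bigr => j _.
  rewrite /t iH scalerA !inE negb_or andbC eq_sym.
  by case: ifP.
- by rewrite /t eqxx !andbF.
rewrite /t [j == i]eq_sym andbCA; case: ifP => [|_]; last by rewrite oppr0.
move=> /and3P[jH iH nij].
rewrite finset.setUCA !simplex_signU // -scaleNr; congr (_ *: _).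
case: ltngtP nij => [_ _|_ _|/val_inj ->]; rewrite ?eqxx //= ?mul1r ?mulN1r.
  by rewrite mulrN mulrC.
by rewrite mulrN opprK mulrC.
Qed.

(** The join with the vertex [i], in the same indexing as [boundary]; it is the contracting homotopy
    of the simplex. *)
Definition cone i c F : V :=
  if i \in F then simplex_sign F i *: c (F :\ i) else 0.

(** If i is not in H, the second summand is zero and only the vertex i contributes to the first. If
    i is in H, adding i back to [H :\ i] in the second summand gives [c H], and every other vertex
    contributes two opposite terms. *)
Lemma boundary_cone i c H : boundary (cone i c) H + cone i (boundary c) H = c H.
Proof.
rewrite /cone; have [iH|iH] := boolP (i \in H); last first.
  rewrite addr0 /boundary (bigD1 i) //= finset.setU11 finset.setU1K //.
  rewrite simplex_signU // ltnn mul1r scalerA simplex_sign_sqr scale1r.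
  rewrite big1 ?addr0 // => j /andP[_ nji].
  by rewrite !inE eq_sym (negPf nji) (negPf iH) scaler0.
have iHi : i \notin H :\ i by rewrite !inE eqxx.
rewrite {2}/boundary (bigD1 i) //= finset.setD1K // scalerDr scalerA.
rewrite simplex_signD simplex_sign_sqr scale1r addrCA -[RHS]addr0.
congr (_ + _).
rewrite scaler_sumr /boundary.
rewrite (eq_bigl (fun j => (j \notin H :\ i) && (j != i))); last first.
  by move=> j; rewrite !inE; have [->|] := eqVneq j i; rewrite ?iH ?andbT.
rewrite -big_split big1 //= => j /andP[jHi nji].
have jH : j \notin H by move: jHi; rewrite !inE nji.
rewrite !inE iH orbT !scalerA simplex_signU //.
have -> : (j |: H) :\ i = j |: H :\ i.
  apply/setP => l; rewrite !inE; have [->|//] := eqVneq l i.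
  by rewrite eq_sym (negPf nji).
(* With H written as [i |: H :\ i] in the sign at j, both terms carry the same two signs, and the
   first has the extra factor -1 from whichever of i < j and j < i holds. *)
rewrite -scalerDl -{1}(finset.setD1K iH) simplex_signU //.
by case: ltngtP nji => [_ _|_ _|/val_inj ->];
  rewrite ?eqxx //= !mul1r mulN1r 1?mulrN ?mulNr [X in _ + X]mulrC
    ?addNr ?addrN scale0r.
Qed.

End Simplex.

(** * Transport of the Taylor complex to the simplex, and exactness *)

Section Exactness.
Variables (k : comPzRingType) (n : nat) (q : skew_matrix k n).
Variables (s : nat) (m : 'I_s -> multinom n).
Local Notation R := (skewpoly q).
Local Notation taylor_index p := {F : {set 'I_s} | #|F| == p}.
Local Notation taylor_ffun p := {ffun taylor_index p -> R^c^o}.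
Local Notation lcm_mono := (lcm_mono m).
Implicit Types (F H : {set 'I_s}) (a : multinom n) (i : 'I_s).

Lemma lcm_monoP F a :
  reflect (forall i, i \in F -> (m i <= a)%MM) (lcm_mono F <= a)%MM.
Proof.
rewrite /Defs.lcm_mono.
rewrite (big_morph (fun b => (b <= a)%MM) (id1 := true) (op1 := andb)).
- by rewrite big_andE; apply: (iffP forall_inP).
- by move=> b c; apply: lem_mlcm.
by apply/mnm_lepP => l; rewrite mnm0E.
Qed.

Lemma lcm_mono_sub F H : F \subset H -> (lcm_mono F <= lcm_mono H)%MM.
Proof.
move=> /fintype.subsetP sFH; apply/lcm_monoP => i /sFH.
by move: i; apply/lcm_monoP; apply: lepm_refl.
Qed.

(** The factor [colorCV] in the differential is the inverse of the constant produced by this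
    product, so only the sign is left. *)
Lemma mono_taylor_coef F i :
  skewmono q (lcm_mono (F :\ i)) * taylor_coef q m F i =
  simplex_sign k F i *: skewmono q (lcm_mono F).
Proof.
rewrite /taylor_coef -skew_scaleAr skewmonoM scalerA -mulrA.
rewrite [colorCV _ _ _ * _]mulrC colorCVr mulr1 addmC submK //.
by apply: lcm_mono_sub; apply: subD1set.
Qed.

(** Defined on all subsets, with value 0 at the wrong cardinality, so that [boundary] and [cone]
    apply without tracking sizes. *)
Definition taylor_embed p (v : taylor_module q s p) F : R :=
  if insub F is Some F' then skewmono q (lcm_mono F) * (v : taylor_ffun p) F'
  else 0.

Lemma taylor_embed_val p (v : taylor_module q s p) (F : taylor_index p) :
  taylor_embed v (val F) =
  skewmono q (lcm_mono (val F)) * (v : taylor_ffun p) F.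
Proof. by rewrite /taylor_embed valK. Qed.

Lemma taylor_embed_out p (v : taylor_module q s p) F :
  #|F| != p -> taylor_embed v F = 0.
Proof. by move=> pF; rewrite /taylor_embed insubF // (negPf pF). Qed.

Lemma taylor_embed_in p (v : taylor_module q s p) F :
  supp_in (fun a => (lcm_mono F <= a)%MM) (taylor_embed v F).
Proof.
rewrite /taylor_embed; case: insub => [F'|]; last exact: supp_in0.
exact: supp_in_monoM.
Qed.

Lemma taylor_embed0 p F : taylor_embed (0 : taylor_module q s p) F = 0.
Proof. by rewrite /taylor_embed; case: insub => // F'; rewrite ffunE mulr0. Qed.

Lemma taylor_embed_inj p (u v : taylor_module q s p) :
  taylor_embed u =1 taylor_embed v -> u = v.
Proof.
move=> E; apply/ffunP => F; have := E (val F).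
by rewrite !taylor_embed_val => /mono_mulI.
Qed.

(** Divisibility of [c F] by x^(m_F) lets [mono_lquo] recover the coordinate at F. *)
Lemma taylor_embed_surj p (c : {set 'I_s} -> R) :
  (forall F, #|F| != p -> c F = 0) ->
  (forall F, supp_in (fun a => (lcm_mono F <= a)%MM) (c F)) ->
  exists v : taylor_module q s p, taylor_embed v =1 c.
Proof.
move=> c0 cF.
exists ([ffun F : taylor_index p => mono_lquo (lcm_mono (val F)) (c (val F))]).
move=> F; rewrite /taylor_embed; case: insubP => [F' _ <-|/c0 //].
by rewrite ffunE mono_lquoK.
Qed.

Lemma taylor_embed_diff p (v : taylor_module q s p.+1) :
  taylor_embed (taylor_diff m v) =1 boundary (taylor_embed v).
Proof.
move=> H; rewrite /boundary.
have [pH|pH] := eqVneq #|H| p; last first.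
  rewrite taylor_embed_out // big1 // => i iH.
  by rewrite taylor_embed_out ?scaler0 // cardsU1 iH.
have [H' EH] : exists H' : taylor_index p, val H' = H.
  by exists (Sub H (introT eqP pH)).
rewrite -{1}EH taylor_embed_val EH /taylor_diff sum_ffunE mulr_sumr.
(* The contribution at H of removing [i] from [F], simplified by [mono_taylor_coef]. *)
pose t F i := if (i \in F) && (F :\ i == H)
  then simplex_sign k F i *: taylor_embed v F else 0.
transitivity (\sum_(F : taylor_index p.+1) \sum_i t (val F) i).
  apply: eq_bigr => F _; rewrite taylor_moduleZ sum_ffunE mulr_suml mulr_sumr.
  rewrite big_mkcond; apply: eq_bigr => i _; rewrite /t.
  case: ifP => //= iF.
  rewrite taylor_moduleZ ffunE EH eq_sym.
  have [<-|_] := eqVneq; last by rewrite !mul0r mulr0.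
  by rewrite mul1r mulrA mono_taylor_coef -skew_scaleAl -taylor_embed_val.
(* Subsets of other sizes may be added, as [taylor_embed v] vanishes there. *)
transitivity (\sum_F \sum_i t F i).
  rewrite [RHS](bigID (fun F : {set 'I_s} => #|F| == p.+1)) /=.
  rewrite [X in _ = _ + X]big1 ?addr0 => [|F pF].
    rewrite (reindex_omap (J := taylor_index p.+1) val insub) => [|F pF].
    by apply: eq_bigl => F; rewrite valK eqxx (valP F).
    by rewrite insubT.
  rewrite big1 // => i _; rewrite /t; case: ifP => // _.
  by rewrite taylor_embed_out ?scaler0.
(* For fixed [i], only F = [i |: H] can contribute, and nothing does when i is in H. *)
rewrite exchange_big [RHS]big_mkcond; apply: eq_bigr => i _ /=.
have [iH|iH] := boolP (i \in H).
  rewrite big1 // => F _; rewrite /t; case: ifP => // /andP[_ /eqP E].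
  by move: iH; rewrite -E !inE eqxx.
rewrite (bigD1 (i |: H)) //= big1 ?addr0 => [|F nF].
  by rewrite /t finset.setU11 finset.setU1K // eqxx simplex_signU // ltnn mul1r.
rewrite /t; case: ifP => // /andP[iF /eqP E].
by move: nF; rewrite -E finset.setD1K ?eqxx.
Qed.

Lemma taylor_diff_diff p (v : taylor_module q s p.+2) :
  taylor_diff m (taylor_diff m v) = 0.
Proof.
apply: taylor_embed_inj => H; rewrite taylor_embed0 taylor_embed_diff.
rewrite -[RHS](boundary_boundary (taylor_embed v) H).
by apply: eq_bigr => i _; rewrite taylor_embed_diff.
Qed.

(* In the component of exponent a the cone point is [pick i | m i <= a]. *)
Lemma taylor_diff_lift p (v : taylor_module q s p) :
  (forall H, boundary (taylor_embed v) H = 0) ->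
  (forall F, supp_in (fun a => exists i, (m i <= a)%MM) (taylor_embed v F)) ->
  exists w : taylor_module q s p.+1, taylor_diff m w = v.
Proof.
move=> dv sv; pose part i : R -> R :=
  restrict (fun a => [pick i | (m i <= a)%MM] == Some i).
pose c F := \sum_i part i (cone i (taylor_embed v) F).
have [w wE] : exists w : taylor_module q s p.+1, taylor_embed w =1 c.
  apply: taylor_embed_surj => F => [pF|].
    rewrite /c big1 // => i _; rewrite /part /cone.
    case: ifP => iF; last exact: raddf0.
    rewrite taylor_embed_out ?scaler0 ?raddf0 //.
    by apply: contraNneq pF => <-; rewrite (cardsD1 i) iF.
  apply: supp_in_sum => i _; rewrite /part /cone.
  case: ifP => iF; last by rewrite raddf0; apply: supp_in0.
  apply: (restrict_in (P := fun a => (lcm_mono (F :\ i) <= a)%MM)).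
    by apply: supp_inZ; apply: taylor_embed_in.
  (* The embedding gives divisibility by m_l for l in F other than i; the choice of i as cone point
     gives it for m_i. *)
  move=> a Fia; case: pickP => // j mja /eqP[Eji]; apply/lcm_monoP => l lF.
  have [->|nli] := eqVneq l i; first by rewrite -Eji.
  by move/lcm_monoP: Fia; apply; rewrite !inE nli.
exists w; apply: taylor_embed_inj => H; rewrite taylor_embed_diff.
transitivity (boundary c H); first by apply: eq_bigr => i _; rewrite wE.
(* By [sv] every occurring exponent has some m_i below it, so [pick] never returns [None] and these
   parts add up to the whole. *)
transitivity (\sum_i part i (taylor_embed v H)); last first.
  rewrite -(big_map Some predT (fun t => restrict
    (fun a => [pick i | (m i <= a)%MM] == t) (taylor_embed v H))).
  symmetry; apply: restrict_sum.
    by rewrite map_inj_uniq ?index_enum_uniq // => i j [].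
  move=> a /sv[i mia]; case: pickP => [j _|/(_ i)]; last by rewrite mia.
  by rewrite map_f ?mem_index_enum.
(* As [part i] is [k]-linear, it commutes with the signed sums, and [boundary_cone] applies to each
   cone point separately. *)
rewrite /boundary /c.
under eq_bigr do rewrite scaler_sumr.
rewrite exchange_big; apply: eq_bigr => i _ /=.
rewrite -[in RHS](boundary_cone i (taylor_embed v) H) /part raddfD /=.
have -> : cone i (boundary (taylor_embed v)) H = 0.
  by rewrite /cone dv scaler0 if_same.
rewrite raddf0 addr0 raddf_sum /=.
by apply: eq_bigr => j _; rewrite linearZ.
Qed.

(** Multiplication by x^a scales coefficients by units and so loses no monomial; hence the degree
    can be read back from the product. *)
Lemma skew_comp_monoM (d : 'I_n -> int) g a (f : R) :
  skew_comp d g (skewmono q a * f) <->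
  skew_comp d ((mono_bideg q d a)^-1 * g)%g f.
Proof.
split=> [/supp_inP fg|fg].
  apply/supp_inP => b nz; rewrite -(fg (a + b)%MM) ?mono_bidegD ?mulKg //.
  apply: contra_neq nz => /(congr1 ( *%R (colorCV q a b))).
  by rewrite coef_monoM mulrA [colorCV _ _ _ * _]mulrC colorCVr mul1r mulr0.
rewrite -[g](mulVKg (mono_bideg q d a)); apply: skew_compM fg.
exact: supp_in_term.
Qed.

(** This holds because e_F and x^(m_F) have the same degree. It makes degree preservation immediate,
    since [boundary] only has signs as coefficients. *)
Lemma taylor_comp_embed (d : 'I_n -> int) p g (v : taylor_module q s p) :
  taylor_comp d m g v <-> forall F, skew_comp d g (taylor_embed v F).
Proof.
split=> [vg F|vg F].
  rewrite /taylor_embed; case: insubP => [F' _ <-|_]; last exact: supp_in0.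
  exact/skew_comp_monoM.
by apply/skew_comp_monoM; rewrite -taylor_embed_val.
Qed.

Lemma taylor_diff_comp (d : 'I_n -> int) p :
  degree_preserving (@taylor_comp k n q d s m p.+1) (@taylor_comp k n q d s m p)
    (@taylor_diff k n q s m p).
Proof.
move=> g v /taylor_comp_embed vg; apply/taylor_comp_embed => H.
rewrite taylor_embed_diff; apply: supp_in_sum => i _; apply: supp_inZ.
exact: vg.
Qed.

(** As the lcm over the empty set is 1, the embedding takes the single coordinate of [v] as its
    value there, and it is 0 on all other subsets. *)
Lemma taylor_aug0 (v : taylor_module q s 0) :
  taylor_aug m v = 0 <->
  forall F, supp_in (fun a => exists i, (m i <= a)%MM) (taylor_embed v F).
Proof.
have E0 : taylor_embed v finset.set0 = (v : taylor_ffun 0) (empty_index s).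
  have -> : finset.set0 = val (empty_index s) by [].
  by rewrite taylor_embed_val /= /Defs.lcm_mono big_set0 skewmono0 mul1r.
rewrite /taylor_aug quotient_pi0 -E0; split=> [H F|//].
have [/eqP|F0] := eqVneq #|F| 0%N; first by rewrite cards_eq0 => /eqP ->.
by rewrite taylor_embed_out //; apply: supp_in0.
Qed.

End Exactness.

Theorem theorem3p4 (k : comPzRingType) (n : nat) (hn : (0 < n)%N)
    (q : skew_matrix k n) (d : 'I_n -> int) (hd : forall i, 0 < d i)
    (s : nat) (m : 'I_s -> multinom n) :
  graded_free_resolution
    (@skew_comp k n q d)
    (@taylor_comp k n q d s m)
    (fun p => @taylor_diff k n q s m p)
    (@mono_quotient_comp k n q d s m)
    (@taylor_aug k n q s m).
Proof.
split.
- exact: skew_comp_graded.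
- exact: taylor_graded_free.
- exact: mono_quotient_graded.
- exact: taylor_diff_comp.
- move=> g v vg; exists ((v : {ffun _ -> _}) (empty_index s)) => //.
  have := vg (empty_index s); rewrite /= /lcm_mono big_set0 mono_bideg0.
  by rewrite invg1 mul1g.
- move=> y; have [x ->] := quotient_piK y.
  by exists [ffun=> x]; rewrite /= /taylor_aug ffunE.
- move=> v; split=> [/taylor_aug0 sv|[w <-]].
    apply: taylor_diff_lift sv => H.
    (* Each [i |: H] is nonempty, while elements of T_0 embed with value 0 off the empty set. *)
    rewrite /boundary big1 // => i iH.
    by rewrite taylor_embed_out ?scaler0 // cardsU1 iH.
  apply/taylor_aug0 => F; rewrite taylor_embed_diff.
  apply: supp_in_sum => i _; apply: supp_inZ => a /taylor_embed_in Fia.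
  by exists i; move/lcm_monoP: Fia; apply; rewrite finset.setU11.
move=> p v; split=> [dv|[w <-]]; last exact: taylor_diff_diff.
apply: taylor_diff_lift => [H|F].
  by rewrite -taylor_embed_diff dv taylor_embed0.
(* In positive homological degree the value at the empty set is 0; otherwise any i in F works, as
   m_i divides m_F. *)
have [->|[i iF]] := set_0Vmem F.
  by rewrite taylor_embed_out ?cards0 //; apply: supp_in0.
by move=> a /taylor_embed_in/lcm_monoP Fa; exists i; apply: Fa.
Qed.
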